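(* Let $H$ be a separable complex Hilbert space and let $\mathbf A=(T_{kj})_{k,j\in\mathbb N}$ and $\mathbf B=(S_{kj})_{k,j\in\mathbb N}$ be matrices with entries in $\mathcal B(H)$. If $\mathbf A,\mathbf B\in\mathcal B(\ell^2(H))$, then $\mathbf A*\mathbf B\in\mathcal B(\ell^2(H))$. Moreover $$\|\mathbf A*\mathbf B\|_{\mathcal B(\ell^2(H))}\le\|\mathbf A\|_{\mathcal B(\ell^2(H))}\,\|\mathbf B\|_{\mathcal B(\ell^2(H))}.$$
   Context: $\mathbb N=\{1,2,\dots\}$; $\mathcal B(H)$ is the space of bounded linear operators on $H$. $\ell^2(H)$ is the Hilbert space of sequences $\mathbf x=(x_j)_{j\in\mathbb N}$ in $H$ with $\|\mathbf x\|_{\ell^2(H)}=(\sum_j\|x_j\|^2)^{1/2}<\infty$, and $c_{00}(H)$ is its subspace of finitely supported sequences. For a matrix $\mathbf A=(T_{kj})$ with entries in $\mathcal B(H)$ and $\mathbf x\in c_{00}(H)$, put $\mathbf A(\mathbf x)=\big(\sum_{j}T_{kj}(x_j)\big)_{k}$. One writes $\mathbf A\in\mathcal B(\ell^2(H))$ if there is $C\ge0$ with $\|\mathbf A(\mathbf x)\|_{\ell^2(H)}\le C\|\mathbf x\|_{\ell^2(H)}$ for all $\mathbf x\in c_{00}(H)$ (so that $\mathbf x\mapsto\mathbf A(\mathbf x)$ extends to a bounded operator on $\ell^2(H)$); $\|\mathbf A\|_{\mathcal B(\ell^2(H))}$ is the least such $C$. The Schur product is $\mathbf A*\mathbf B=(T_{kj}S_{kj})$,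 where $T_{kj}S_{kj}$ is the composition of operators. *)

(* Defs.v *)
From HB Require Import structures.
From mathcomp Require Import all_boot all_order all_algebra.
From mathcomp Require Import all_classical all_reals all_analysis.
From mathcomp Require Export complex.

Set Implicit Arguments.
Unset Strict Implicit.
Unset Printing Implicit Defensive.

Import Order.TTheory GRing.Theory Num.Theory.
Import numFieldNormedType.Exports.

Local Open Scope classical_set_scope.
Local Open Scope ring_scope.
Local Open Scope complex_scope.

Definition separable (T : topologicalType) : Prop :=
  exists2 D : set T, countable D & dense D.

(* The inner product is linear in its first argument, conjugate-linear in the
   second and, being of type [{dot H for Num.conj}], hermitian and positive
   definite. Completeness is part of [completeNormedModType]. *)
Definition hilbert_norm (R : realType) (H : completeNormedModType R[i])
    (ip : {dot H for Num.conj}) : Prop :=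
  forall x : H, ip x x = `|x| ^+ 2.

Section bounded_operators.
Context (R : realType) (H : completeNormedModType R[i]).

(* In a normed module over R[i] the norm takes its values in the nonnegative
   reals of R[i]; [rnorm] reads it in R. *)
Definition rnorm (x : H) : R := complex.Re `|x|.

Definition bounded_linear (T : {linear H -> H}) : Prop :=
  exists C : R, forall x : H, rnorm (T x) <= C * rnorm x.

Record bounded_op : Type := BoundedOp {
  bop :> {linear H -> H};
  bopP : bounded_linear bop
}.

Lemma rnorm_ge0 (x : H) : 0 <= rnorm x.
Proof. by rewrite /rnorm -ler0c RRe_real// ger0_real. Qed.

Lemma bounded_linear_comp (T S : bounded_op) :
  bounded_linear (T \o S : {linear H -> H}).
Proof.
have [[C TC] [D SD]] := (bopP T, bopP S).
exists (`|C| * D) => x /=; apply: (le_trans (TC _)).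
rewrite -mulrA; apply: le_trans (ler_wpM2l (normr_ge0 C) (SD x)).
by rewrite ler_wpM2r ?rnorm_ge0 ?ler_norm.
Qed.

Definition comp_op (T S : bounded_op) : bounded_op :=
  BoundedOp (bounded_linear_comp T S).

End bounded_operators.

Section operator_matrices.
Context (R : realType) (H : completeNormedModType R[i]).

Definition l2norm (x : nat -> H) : \bar R :=
  sqrte (\sum_(0 <= j <oo) (rnorm (x j) ^+ 2)%:E)%E.

Definition c00 : set (nat -> H) :=
  [set x | finite_set [set j | x j != 0]].

Definition op_matrix : Type := nat -> nat -> bounded_op H.

(* Only meant for [x] in [c00]: the sum then has finite support. *)
Definition mx_apply (A : op_matrix) (x : nat -> H) : nat -> H :=
  fun k => \sum_(j \in [set: nat]) A k j (x j).

(* [l2norm x] is finite for [x] in [c00], so the inequality in [\bar R] also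
   says that [mx_apply A x] lies in l^2(H). *)
Definition l2_bound (A : op_matrix) (C : R) : Prop :=
  0 <= C /\
  forall x, c00 x -> (l2norm (mx_apply A x) <= C%:E * l2norm x)%E.

Definition l2_bounded (A : op_matrix) : Prop := exists C, l2_bound A C.

(* The infimum is a minimum for [l2_bounded] matrices: see [l2_opnormP]. *)
Definition l2_opnorm (A : op_matrix) : R := inf [set C | l2_bound A C].

Definition schur_product (A B : op_matrix) : op_matrix :=
  fun k j => comp_op (A k j) (B k j).

Lemma l2norm_ge0 (x : nat -> H) : (0 <= l2norm x)%E.
Proof. exact: sqrte_ge0. Qed.

Lemma c00_l2norm_fin (x : nat -> H) : c00 x -> l2norm x \is a fin_num.
Proof.
move=> /finite_seqP[s sx].
have [N xN] : exists N, forall j, (N <= j)%N -> x j = 0.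
  exists (\max_(j <- s) j).+1 => j Nj; apply/eqP/negPn/negP => xj0.
  have : [set` s] j by rewrite -sx.
  move=> /= js; have := @leq_bigmax_seq _ s xpredT id j js isT.
  by rewrite leqNgt Nj.
rewrite sqrte_fin_num; last first.
  by apply: nneseries_ge0 => j _ _; rewrite lee_fin sqr_ge0.
rewrite (nneseries_split 0 N) ?add0n; last first.
  by move=> j _; rewrite lee_fin sqr_ge0.
rewrite [X in (_ + X)%E]eseries0; last first.
  by move=> j Nj _; rewrite xN// /rnorm normr0 expr0n.
by rewrite adde0 sumEFin.
Qed.

Lemma l2_opnormP (A : op_matrix) :
  l2_bounded A -> l2_bound A (l2_opnorm A) /\
  forall C, l2_bound A C -> l2_opnorm A <= C.
Proof.
move=> [C0 AC0].
have lb0 : lbound [set C | l2_bound A C] 0 by move=> C [].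
have le_inf C : l2_bound A C -> l2_opnorm A <= C.
  by move=> AC; apply: ge_inf => //; exists 0.
split=> //; split; first by apply: lb_le_inf => //; exists C0.
move=> x x0; apply/lee_addgt0Pr => e e0.
set n := fine (l2norm x).
have nE : l2norm x = n%:E by rewrite fineK// c00_l2norm_fin.
have n0 : 0 <= n by rewrite fine_ge0// l2norm_ge0.
have d0 : 0 < e / (n + 1) by rewrite divr_gt0// ltr_wpDl.
have [C /= [_ AC] Clt] : exists2 C, l2_bound A C & C < l2_opnorm A + e / (n + 1).
  by apply: inf_adherent => //; split; [exists C0 | exists 0].
apply: (le_trans (AC x x0)); rewrite nE -!EFinM -EFinD lee_fin.
apply: (@le_trans _ _ ((l2_opnorm A + e / (n + 1)) * n)).
  by rewrite ler_wpM2r// ltW.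
rewrite mulrDl lerD2l mulrAC ler_pdivrMr ?ltr_wpDl//.
by rewrite ler_wpM2l ?ltW// ltrDl.
Qed.

End operator_matrices.

(* Main.v *)
Require Import Defs.
From HB Require Import structures.
From mathcomp Require Import all_boot all_order all_algebra.
From mathcomp Require Import all_classical all_reals all_analysis.

(* The k-th entry of (A * B)(x) is the k-th entry of A applied to the sequence
   (S_kj x_j)_j, so its square norm is at most |A|^2 \sum_j |S_kj x_j|^2. On the
   other hand (S_kj x_j)_k is the image under B of the sequence whose only
   entry is x_j, in position j, so \sum_k |S_kj x_j|^2 <= |B|^2 |x_j|^2. It
   remains to sum over k and exchange the two sums. *)

Import Order.TTheory GRing.Theory Num.Theory.
Import numFieldNormedType.Exports.

Local Open Scope classical_set_scope.
Local Open Scope ring_scope.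
Local Open Scope complex_scope.

Section schur.
Context {R : realType} {H : completeNormedModType R[i]}.
Implicit Types (A B : op_matrix H) (x : nat -> H).

(** The sum under the root in [l2norm]. Bounds are proved for it because sums of squares can be
    exchanged; values in [\bar R] avoid convergence conditions. *)
Definition l2sq x : \bar R := (\sum_(0 <= j <oo) (rnorm (x j) ^+ 2)%:E)%E.

Lemma l2sq_ge0 x : (0 <= l2sq x)%E.
Proof. by apply: nneseries_ge0 => j _ _; rewrite lee_fin sqr_ge0. Qed.

Lemma l2sq_ge_entry x k : ((rnorm (x k) ^+ 2)%:E <= l2sq x)%E.
Proof.
rewrite /l2sq (@nneseriesD1 _ _ k)//; last by move=> j _; rewrite lee_fin sqr_ge0.
by rewrite leeDl// nneseries_ge0// => j _ _; rewrite lee_fin sqr_ge0.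
Qed.

(** [sqrte] is multiplicative and monotone on nonnegative extended reals, and [C] is the root of its
    square as [0 <= C]. *)
Lemma l2norm_le_mul x y {C : R} : 0 <= C ->
  (l2norm x <= C%:E * l2norm y)%E = (l2sq x <= (C ^+ 2)%:E * l2sq y)%E.
Proof.
move=> C0; have C20 : (0 <= (C ^+ 2)%:E :> \bar R)%E by rewrite lee_fin sqr_ge0.
have CE : C%:E = sqrte (C ^+ 2)%:E by rewrite /= sqrtr_sqr ger0_norm.
by rewrite CE -sqrteM// lee_sqrt// mule_ge0// l2sq_ge0.
Qed.

Lemma l2_bound_sq {A} {C : R} {x} : l2_bound A C -> c00 x ->
  (l2sq (mx_apply A x) <= (C ^+ 2)%:E * l2sq x)%E.
Proof. by move=> [C0 leC] x0; rewrite -l2norm_le_mul//; apply: leC. Qed.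

Definition single (j : nat) (v : H) : nat -> H := fun i => if i == j then v else 0.

Lemma c00_single j v : c00 (single j v).
Proof.
apply: (@sub_finite_set _ _ [set j]) => [i /=|]; last exact: finite_set1.
by rewrite /single; case: (i =P j) => // _; rewrite eqxx.
Qed.

Lemma l2sq_single j v : l2sq (single j v) = (rnorm v ^+ 2)%:E.
Proof.
rewrite /l2sq (@nneseriesD1 _ _ j)//; last by move=> i _; rewrite lee_fin sqr_ge0.
rewrite /single eqxx eseries0 ?adde0// => i _ /= /negPf ->.
by rewrite /rnorm normr0 expr0n.
Qed.

Lemma mx_apply_single B j v k : mx_apply B (single j v) k = B k j v.
Proof.
rewrite /mx_apply -(@fsbig_widen _ _ _ _ [set j])//.
  by rewrite fsbig_set1 /single eqxx.
by move=> i [_ /=]; rewrite /single; case: eqP => // _ _; rewrite linear0.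
Qed.

Lemma l2_bound_column {B} {C : R} j v : l2_bound B C ->
  (\sum_(0 <= k <oo) (rnorm (B k j v) ^+ 2)%:E <= (C ^+ 2 * rnorm v ^+ 2)%:E)%E.
Proof.
move=> BC; rewrite EFinM -(l2sq_single j).
under eq_eseriesr do rewrite -mx_apply_single.
exact: l2_bound_sq BC (c00_single j v).
Qed.

Lemma l2_bound_schur {A B} {a b : R} : l2_bound A a -> l2_bound B b ->
  l2_bound (schur_product A B) (a * b).
Proof.
move=> Aa Bb; have [a0 _] := Aa; have [b0 _] := Bb.
split=> [|x x0]; first exact: mulr_ge0.
rewrite l2norm_le_mul ?mulr_ge0//.
pose z k j := B k j (x j).
(* The bound on [A] speaks of finitely supported sequences only; the support of [z k] lies in that
   of [x]. *)
have z0 k : c00 (z k).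
  apply: sub_finite_set x0 => j /=; apply: contra_neq => xj0.
  by rewrite /z xj0 linear0.
have nnz k j : (0 <= (rnorm (z k j) ^+ 2)%:E)%E by rewrite lee_fin sqr_ge0.
apply: (@le_trans _ _ (\sum_(0 <= k <oo) (a ^+ 2)%:E * l2sq (z k))%E).
  apply: lee_nneseries => [k _ _|k _]; first by rewrite lee_fin sqr_ge0.
  (* By conversion, the entry [k] of the Schur product at [x] is the entry [k] of
     [mx_apply A (z k)]. *)
  exact: le_trans (l2sq_ge_entry (mx_apply A (z k)) k) (l2_bound_sq Aa (z0 k)).
rewrite nneseriesZl => [|k _]; last exact: l2sq_ge0.
rewrite exprMn [in leRHS]EFinM -muleA lee_wpmul2l ?lee_fin ?sqr_ge0//.
(* Tonelli for nonnegative terms: the inner sum now runs down column [j] of [B] at the fixed vector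
   [x j]. *)
rewrite /l2sq nneseries_interchange// -nneseriesZl; last first.
  by move=> j _; rewrite lee_fin sqr_ge0.
apply: lee_nneseries => [j _ _|j _]; first exact: nneseries_ge0.
by rewrite -EFinM; apply: l2_bound_column.
Qed.

End schur.

Theorem theorem4p7 (R : realType) (H : completeNormedModType R[i])
    (ip : {dot H for Num.conj}) (hip : hilbert_norm ip) (hsep : separable H)
    (A B : op_matrix H) (hA : l2_bounded A) (hB : l2_bounded B) :
  l2_bounded (schur_product A B) /\
  l2_opnorm (schur_product A B) <= l2_opnorm A * l2_opnorm B.
Proof.
(* The infima are attained, so the two norms are themselves admissible bounds and no limiting
   argument is needed. *)
have [[boundA _] [boundB _]] := (l2_opnormP hA, l2_opnormP hB).
have boundAB := l2_bound_schur boundA boundB.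
have bddAB : l2_bounded (schur_product A B) by exists (l2_opnorm A * l2_opnorm B).
by split=> //; have [_] := l2_opnormP bddAB; apply.
Qed.
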